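(* Let $\mathcal{H}$, $\{e_{jl}\}$, $\{\lambda_j\}$ and $H^\infty_E$ be as in the context. Then $H^\infty_E$ is a perfect space, that is, $$\left[\widehat{H^\infty_E}\right]^{\wedge}=H^\infty_E .$$
   Context: Let $\mathcal{H}$ be a separable complex Hilbert space, and let $\{e_{jl} : j\in\mathbb{N},\ 1\le l\le d_j\}$, with $d_j\in\mathbb{N}$ (positive integers) and $\mathbb{N}=\{1,2,\dots\}$, be an orthonormal basis of $\mathcal{H}$. Let $0<\lambda_1\le\lambda_2\le\cdots$ be a sequence of positive numbers such that $\sum_{j=1}^\infty d_j\lambda_j^{-s_0}<\infty$ for some $s_0>0$. The associated operator is $Ef=\sum_j\sum_{l}\lambda_j (f,e_{jl})_{\mathcal{H}}e_{jl}$ (defined where the series converges in $\mathcal{H}$); it serves only to label the spaces. For $f\in\mathcal{H}$ put $\widehat f(j,l)=(f,e_{jl})_{\mathcal{H}}$ and $\widehat f(j)=(\widehat f(j,l))_{1\le l\le d_j}\in\mathbb{C}^{d_j}$. For $a\in\mathbb{C}^{d}$, $\|a\|_{\mathtt{HS}}=(\sum_{l=1}^{d}|a_l|^2)^{1/2}$. The space of smooth type functions is $$H^\infty_E=\Big\{\phi\in\mathcal{H}:\ \sum_{j=1}^\infty\lambda_j^{2s}\|\widehat\phi(j)\|_{\mathtt{HS}}^2<\infty\ \text{for all } s\in\mathbb{R}\Big\}.$$ An element $\phi\in H^\infty_E$ is identified with its sequence of coefficients $(\widehat\phi(j))_{j\in\mathbb{N}}$, so that $H^\infty_E$ is viewed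 as a linear subspace of $\Sigma=\{v=(v_j)_{j\in\mathbb{N}}: v_j=(v_{jl})_{1\le l\le d_j}\in\mathbb{C}^{d_j}\}$. For a linear subspace $V\subseteq\Sigma$, its $\alpha$-dual is $$\widehat V=V^{\wedge}=\Big\{w\in\Sigma:\ \sum_{j=1}^\infty\sum_{l=1}^{d_j}|v_{jl}||w_{jl}|<\infty\ \text{for all } v\in V\Big\}.$$ $V$ is called perfect if $\widehat{\widehat V}=V$. *)

(* Defs.v *)
From HB Require Import structures.
From mathcomp Require Import all_boot all_order all_algebra.
From mathcomp Require Import sesquilinear.
From mathcomp Require Import all_classical all_reals all_analysis.
From mathcomp Require Import complex.
Set Implicit Arguments.
Unset Strict Implicit.
Unset Printing Implicit Defensive.
Import Order.TTheory GRing.Theory Num.Theory.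
Import numFieldNormedType.Exports.
Local Open Scope classical_set_scope.
Local Open Scope ring_scope.

(* The index set {1, 2, ...} for j is shifted to nat, and 1 <= l <= d_j is
   rendered by 'I_(d j).  All series below have nonnegative terms, so that
   "the series converges" is "its sum in \bar R is < +oo". *)

Definition separable (T : topologicalType) :=
  exists2 D : set T, countable D & dense D.

(* A complex Hilbert space is a completeNormedModType over R[i] with an inner
   product (linear in the first argument) that induces its norm. *)
Definition induces_norm (R : realType) (H : normedModType R[i])
    (ip : {dot H for @Num.conj R[i]}) :=
  forall f : H, `|f| ^+ 2 = ip f f.

Definition orthonormal_family (R : realType) (H : normedModType R[i])
    (ip : {dot H for @Num.conj R[i]}) (d : nat -> nat)
    (e : forall j, 'I_(d j) -> H) :=
  forall p q : {j : nat & 'I_(d j)},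
    ip (e (tag p) (tagged p)) (e (tag q) (tagged q)) = (p == q)%:R.

Definition lin_span (R : realType) (H : normedModType R[i]) (d : nat -> nat)
    (e : forall j, 'I_(d j) -> H) : set H :=
  [set f | exists (n : nat) (c : forall j, 'I_(d j) -> R[i]),
     f = \sum_(j < n) \sum_(l < d j) c j l *: e j l].

Definition orthonormal_basis (R : realType) (H : normedModType R[i])
    (ip : {dot H for @Num.conj R[i]}) (d : nat -> nat)
    (e : forall j, 'I_(d j) -> H) :=
  orthonormal_family ip e /\ dense (lin_span e).

Definition Sigma (R : realType) (d : nat -> nat) : Type :=
  forall j : nat, 'rV[R[i]]_(d j).

Definition HS_norm (R : realType) (n : nat) (a : 'rV[R[i]]_n) : R :=
  Num.sqrt (\sum_(l < n) ComplexField.Normc.normc (a 0 l) ^+ 2).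

Definition fourier (R : realType) (H : normedModType R[i])
    (ip : {dot H for @Num.conj R[i]}) (d : nat -> nat)
    (e : forall j, 'I_(d j) -> H) (f : H) : Sigma R d :=
  fun j => \row_(l < d j) ip f (e j l).

Definition Hinfty (R : realType) (H : normedModType R[i])
    (ip : {dot H for @Num.conj R[i]}) (d : nat -> nat)
    (e : forall j, 'I_(d j) -> H) (lambda : nat -> R) : set H :=
  [set phi | forall s : R,
     (\sum_(0 <= j <oo)
        (lambda j `^ (2 * s) * HS_norm (fourier ip e phi j) ^+ 2)%:E < +oo)%E].

(* Hinfty viewed inside Sigma: an element is identified with its sequence of
   Fourier coefficients. *)
Definition Hinfty_seq (R : realType) (H : normedModType R[i])
    (ip : {dot H for @Num.conj R[i]}) (d : nat -> nat)
    (e : forall j, 'I_(d j) -> H) (lambda : nat -> R) : set (Sigma R d) :=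
  fourier ip e @` Hinfty ip e lambda.

(* Both notions make sense for an arbitrary subset V of Sigma; they are used
   for linear subspaces. *)
Definition alpha_dual (R : realType) (d : nat -> nat) (V : set (Sigma R d)) :
    set (Sigma R d) :=
  [set w | forall v : Sigma R d, V v ->
     (\sum_(0 <= j <oo)
        (\sum_(l < d j) ComplexField.Normc.normc (v j 0 l)
                        * ComplexField.Normc.normc (w j 0 l))%:E < +oo)%E].

Definition perfect (R : realType) (d : nat -> nat) (V : set (Sigma R d)) :=
  alpha_dual (alpha_dual V) = V.

(* Main.v *)
Require Import Defs.
From HB Require Import structures.
From mathcomp Require Import all_boot all_order all_algebra.
From mathcomp Require Import sesquilinear.
From mathcomp Require Import all_classical all_reals all_analysis.
From mathcomp Require Import complex.
From mathcomp Require Import lra.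
Import Order.TTheory GRing.Theory Num.Theory.
Import numFieldNormedType.Exports.
Local Open Scope classical_set_scope.
Local Open Scope ring_scope.

(** By the Riesz-Fischer theorem the coefficient sequences of the elements of
    [Hinfty] are exactly the sequences [w] such that
    [\sum_j lambda_j ^ (2 s) |w_j|^2 < oo] for every real [s]
    ([Hinfty_seqE]); this is the only place where the Hilbert space matters.
    What is left is a statement about sequences ([rapid_decay_perfect]).

    The inclusion of a space in its double dual always holds.  For the
    converse, the power sequences [u_jl = lambda_j ^ t] are tested.  Every one
    of them lies in the dual of the space ([power_seq_dual]): splitting
    [lambda_j ^ t |v_jl|] as the product of [x = lambda_j ^ (- s0 / 2)] and
    [y = lambda_j ^ (t + s0 / 2) |v_jl|], the inequality [x y <= x^2 + y^2]
    bounds the pairing by [\sum_j d_j lambda_j ^ (- s0)] plus a weighted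
    l^2-sum of [v].  Hence a [w] in the double dual satisfies
    [\sum_j lambda_j ^ t \sum_l |w_jl| < oo] for every [t].  A summable
    nonnegative sequence is square summable, and the square of the l^1-norm of
    [w_j] dominates that of its l^2-norm, so [w] satisfies all the weighted
    l^2-conditions. *)

Set Implicit Arguments.
Unset Strict Implicit.
Unset Printing Implicit Defensive.
Local Notation normc := ComplexField.Normc.normc.

(** * Moduli and series of nonnegative reals *)

Lemma norm_normc (R : realType) (z : R[i]) : `|z| = (normc z)%:C%C.
Proof. by case: z. Qed.

Lemma normc_ge0 (R : realType) (z : R[i]) : 0 <= normc z.
Proof. by rewrite -lecR -norm_normc normr_ge0. Qed.

Lemma HS_norm_sqr (R : realType) (n : nat) (a : 'rV[R[i]]_n) :
  HS_norm a ^+ 2 = \sum_(l < n) normc (a 0 l) ^+ 2.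
Proof. by rewrite sqr_sqrtr// sumr_ge0// => l _; rewrite sqr_ge0. Qed.

Lemma powR_sqr (R : realType) (a t : R) : (a `^ t) ^+ 2 = a `^ (2 * t).
Proof. by rewrite mulrC powRrM powR_mulrn// powR_ge0. Qed.

Lemma nneseries_tail_small (R : realType) (a : nat -> R) (eps : R) :
  (forall j, 0 <= a j) -> (\sum_(0 <= j <oo) (a j)%:E < +oo)%E -> 0 < eps ->
  exists N, forall m n, (N <= m)%N -> \sum_(m <= j < n) a j < eps.
Proof.
move=> a0 afin eps0.
have a0E j : (0 <= (a j)%:E)%E by rewrite lee_fin.
have eps0E : (0 < eps%:E)%E by rewrite lte_fin.
have /(_ _ (open_ereal_lt' eps0E))[N _ NP] :=
  nneseries_tail_cvg afin (fun k _ => a0E k).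
exists N => m n /NP/= tail_lt; rewrite -lte_fin -sumEFin.
by apply: le_lt_trans tail_lt; exact: nneseries_lim_ge.
Qed.

Lemma nneseries_lt_pinfty (R : realType) (a b : nat -> R) :
  (forall j, 0 <= a j <= b j) -> (\sum_(0 <= j <oo) (b j)%:E < +oo)%E ->
  (\sum_(0 <= j <oo) (a j)%:E < +oo)%E.
Proof.
move=> ab; apply: le_lt_trans; apply: lee_nneseries => j _.
  by move=> _; rewrite lee_fin; case/andP: (ab j).
by rewrite lee_fin; case/andP: (ab j).
Qed.

(** The terms of a summable sequence are bounded by its sum [M], so that
    [a_j ^ 2 <= M a_j]. *)
Lemma nneseries_sqr_lt_pinfty (R : realType) (a : nat -> R) :
  (forall j, 0 <= a j) -> (\sum_(0 <= j <oo) (a j)%:E < +oo)%E ->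
  (\sum_(0 <= j <oo) (a j ^+ 2)%:E < +oo)%E.
Proof.
move=> a0 afin; have a0E j : (0 <= (a j)%:E)%E by rewrite lee_fin.
have fin : (\sum_(0 <= j <oo) (a j)%:E)%E \is a fin_num.
  by rewrite ge0_fin_numE// nneseries_ge0.
set M := fine (\sum_(0 <= j <oo) (a j)%:E)%E.
have aM j : a j <= M.
  rewrite -lee_fin fineK//.
  apply: le_trans (nneseries_lim_ge j.+1 (fun k _ _ => a0E k)).
  by rewrite big_nat_recr//= leeDr// sume_ge0.
apply: (@nneseries_lt_pinfty _ _ (fun j => M * a j)) => [j|].
  by rewrite sqr_ge0 expr2 ler_wpM2r.
under eq_eseriesr => j _ do rewrite EFinM.
by rewrite nneseriesZl// -(fineK fin) -EFinM ltry.
Qed.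

(** * The Riesz-Fischer theorem *)

Definition block (R : realType) (H : normedModType R[i]) (d : nat -> nat)
    (e : forall j, 'I_(d j) -> H) (w : Sigma R d) (j : nat) : H :=
  \sum_(l < d j) w j 0 l *: e j l.

Lemma ip_block_same (R : realType) (H : normedModType R[i])
    (ip : {dot H for @Num.conj R[i]}) (d : nat -> nat)
    (e : forall j, 'I_(d j) -> H) (w : Sigma R d) (j : nat) (l : 'I_(d j)) :
  orthonormal_family ip e -> ip (block e w j) (e j l) = w j 0 l.
Proof.
move=> eO; rewrite linear_sumlz (bigD1 l)//= big1 => [|k kl].
  rewrite linearZl_LR/= (eO (Tagged (fun j => 'I_(d j)) l)
    (Tagged (fun j => 'I_(d j)) l)) eqxx addr0.
  by rewrite mulr1.
rewrite linearZl_LR/= (eO (Tagged (fun j => 'I_(d j)) k)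
    (Tagged (fun j => 'I_(d j)) l)) eq_Tagged/=.
by rewrite (negbTE kl) mulr0.
Qed.

Lemma ip_block_neq (R : realType) (H : normedModType R[i])
    (ip : {dot H for @Num.conj R[i]}) (d : nat -> nat)
    (e : forall j, 'I_(d j) -> H) (w : Sigma R d) (j k : nat) (m : 'I_(d k)) :
  orthonormal_family ip e -> j != k -> ip (block e w j) (e k m) = 0.
Proof.
move=> eO jk; rewrite linear_sumlz big1// => l _.
rewrite linearZl_LR/= (eO (Tagged (fun j => 'I_(d j)) l)
    (Tagged (fun j => 'I_(d j)) m)).
by rewrite -tag_eqE /tag_eq/= (negbTE jk) mulr0.
Qed.

(** Pythagoras: distinct blocks are orthogonal. *)
Lemma norm_sum_block (R : realType) (H : normedModType R[i])
    (ip : {dot H for @Num.conj R[i]}) (d : nat -> nat)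
    (e : forall j, 'I_(d j) -> H) (w : Sigma R d) (r : seq nat) :
  induces_norm ip -> orthonormal_family ip e -> uniq r ->
  `|\sum_(j <- r) block e w j| ^+ 2 =
    (\sum_(j <- r) HS_norm (w j) ^+ 2)%:C%C.
Proof.
move=> ipE eO ur; rewrite ipE linear_sumr/= rmorph_sum/=.
rewrite [LHS]big_seq [RHS]big_seq; apply: eq_bigr => k kr.
rewrite {2}/block linear_sumr/= HS_norm_sqr rmorph_sum/=.
apply: eq_bigr => l _; rewrite linearZr_LR/= linear_sumlz (bigD1_seq k)//=.
rewrite ip_block_same// big1 ?addr0 => [|j jk]; last exact: ip_block_neq.
by rewrite mulrC -normCK norm_normc rmorphXn.
Qed.

(** The Cauchy-Schwarz inequality against a unit vector, which gives the
    continuity of the Fourier coefficients: it is the nonnegativity of the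
    squared norm of [f - ip f u *: u]. *)
Lemma norm_ip_unit (R : realType) (H : normedModType R[i])
    (ip : {dot H for @Num.conj R[i]}) (u f : H) :
  induces_norm ip -> ip u u = 1 -> `|ip f u| <= `|f|.
Proof.
move=> ipE u1; rewrite -(@ler_pXn2r _ 2)// ?nnegrE ?normr_ge0// ipE -subr_ge0.
have := dnorm_ge0 ip (f - ip f u *: u).
rewrite dnormB dnormZ u1 mulr1 linearZr_LR/=.
have /CrealP -> : (ip f u)^* * ip f u \is Num.real.
  by rewrite mulrC -normCK realX// normr_real.
by rewrite [_^* * _]mulrC -normCK opprD addrA addrK.
Qed.

(** The series of the vectors [block e w j] is Cauchy by [norm_sum_block], so
    it converges by completeness; since coefficients depend continuously on
    the vector, and the one at [(j, l)] is constant along the partial sums of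
    more than [j] blocks, the sum has the prescribed coefficients. *)
Lemma riesz_fischer (R : realType) (H : completeNormedModType R[i])
    (ip : {dot H for @Num.conj R[i]}) (d : nat -> nat)
    (e : forall j, 'I_(d j) -> H) (w : Sigma R d) :
  induces_norm ip -> orthonormal_family ip e ->
  (\sum_(0 <= j <oo) (HS_norm (w j) ^+ 2)%:E < +oo)%E ->
  exists f : H, fourier ip e f = w.
Proof.
move=> ipE eO wfin.
have /cauchy_cvgP/cvg_ex[/= f fP] : cauchy (series (block e w) @ \oo).
  apply/cauchy_seriesP => eps eps0.
  (* A positive element of R[i] is real. *)
  have [r r0 ->] : exists2 r : R, 0 < r & eps = r%:C%C.
    exists (complex.Re eps); last by rewrite RRe_real// gtr0_real.
    by rewrite -ltcR RRe_real// gtr0_real.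
  have [N NP] := nneseries_tail_small (fun j => sqr_ge0 (HS_norm (w j))) wfin
    (exprn_gt0 2 r0).
  exists ([set m | (N <= m)%N], [set m | (N <= m)%N]).
    by split; exists N.
  move=> [m n]/= [Nm Nn].
  rewrite -(@ltr_pXn2r _ 2)// ?nnegrE ?normr_ge0 ?ler0c ?ltW//.
  by rewrite (norm_sum_block _ ipE eO) ?iota_uniq// -rmorphXn ltcR; exact: NP.
exists f; apply: functional_extensionality_dep => j; apply/rowP => l; rewrite mxE.
(* If the coefficient were wrong, its error could be taken as the tolerance
   within which the partial sums approach f: this is absurd. *)
apply/eqP; rewrite -subr_eq0 -normr_eq0; apply/negPn/negP => nz.
have eps0 : 0 < `|ip f (e j l) - w j 0 l| by rewrite lt_def nz normr_ge0.
move/cvgrPdist_lt: fP => /(_ _ eps0)[N _ NP].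
have := NP (maxn N j.+1) (leq_maxl _ _).
rewrite /mkset => /lt_geF/negP; apply.
have -> : w j 0 l = ip (series (block e w) (maxn N j.+1)) (e j l).
  rewrite /series/= linear_sumlz (bigD1_seq j)/= ?iota_uniq//; last first.
    by rewrite mem_index_iota/= leq_maxr.
  by rewrite ip_block_same// big1 ?addr0// => k; exact: ip_block_neq.
rewrite -linearBl; apply: norm_ip_unit => //.
by rewrite (eO (Tagged (fun j => 'I_(d j)) l)
    (Tagged (fun j => 'I_(d j)) l)) eqxx.
Qed.

(** * Rapidly decaying sequences and their duals *)

Definition rapid_decay (R : realType) (d : nat -> nat) (lambda : nat -> R) :
    set (Sigma R d) :=
  [set w | forall s : R,
     (\sum_(0 <= j <oo)
        (lambda j `^ (2 * s) * HS_norm (w j) ^+ 2)%:E < +oo)%E].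
Arguments rapid_decay {R} d lambda.

Lemma Hinfty_seqE (R : realType) (H : completeNormedModType R[i])
    (ip : {dot H for @Num.conj R[i]}) (d : nat -> nat)
    (e : forall j, 'I_(d j) -> H) (lambda : nat -> R) :
  induces_norm ip -> orthonormal_family ip e ->
  Hinfty_seq ip e lambda = rapid_decay d lambda.
Proof.
move=> ipE eO; apply/seteqP; split=> [_ [f + <-]//|w wP].
have [|f fE] := riesz_fischer ipE eO (w := w).
  have := wP 0; rewrite mulr0.
  by under eq_eseriesr => j _ do rewrite powRr0 mul1r.
by exists f => //; move=> s; rewrite fE; exact: wP.
Qed.

Lemma alpha_dual2_ge (R : realType) (d : nat -> nat) (V : set (Sigma R d)) :
  V `<=` alpha_dual (alpha_dual V).
Proof.
move=> v Vv w /(_ v Vv); under eq_eseriesr => j _.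
  by under eq_bigr => l _ do rewrite mulrC; over.
by [].
Qed.

Definition power_seq (R : realType) (d : nat -> nat) (lambda : nat -> R)
    (t : R) : Sigma R d :=
  fun j => const_mx (lambda j `^ t)%:C%C.
Arguments power_seq {R} d lambda t.

Lemma normc_power_seq (R : realType) (d : nat -> nat) (lambda : nat -> R)
    (t : R) (j : nat) (l : 'I_(d j)) :
  normc (power_seq d lambda t j 0 l) = lambda j `^ t.
Proof. by rewrite mxE /= expr0n addr0 sqrtr_sqr ger0_norm ?powR_ge0. Qed.

(** This is where the summability of [d_j lambda_j ^ (- s0)] enters: it pays
    for the passage from the l^2-control of [v] to l^1-control. *)
Lemma power_seq_dual (R : realType) (d : nat -> nat) (lambda : nat -> R)
    (s0 t : R) :
  (forall j, 0 < lambda j) ->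
  (\sum_(0 <= j <oo) ((d j)%:R * lambda j `^ (- s0))%:E < +oo)%E ->
  alpha_dual (rapid_decay d lambda) (power_seq d lambda t).
Proof.
move=> lambda_gt0 lambda_sum v /(_ (t + s0 / 2)) vfin.
apply: (@nneseries_lt_pinfty _ _ (fun j => (d j)%:R * lambda j `^ (- s0) +
    lambda j `^ (2 * (t + s0 / 2)) * HS_norm (v j) ^+ 2)) => [j|]; last first.
  under eq_eseriesr => j _ do rewrite EFinD.
  rewrite nneseriesD ?lte_add_pinfty// => j _ _.
    by rewrite lee_fin mulr_ge0// powR_ge0.
  by rewrite lee_fin mulr_ge0 ?powR_ge0// sqr_ge0.
apply/andP; split.
  by apply: sumr_ge0 => l _; rewrite mulr_ge0// normc_ge0.
have -> : (d j)%:R * lambda j `^ (- s0) =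
    \sum_(l < d j) lambda j `^ (- (s0 / 2)) ^+ 2.
  rewrite sumr_const card_ord mulr_natl powR_sqr.
  by rewrite mulrN mulrC divfK.
rewrite HS_norm_sqr mulr_sumr -big_split/=; apply: ler_sum => l _.
rewrite normc_power_seq.
set x := lambda j `^ (- (s0 / 2)).
pose y := lambda j `^ (t + s0 / 2) * normc (v j 0 l).
have xy : normc (v j 0 l) * lambda j `^ t = x * y.
  rewrite /x /y mulrA -powRD; last by rewrite (gt_eqF (lambda_gt0 j)) implybT.
  by rewrite addrC addrK mulrC.
have -> : lambda j `^ (2 * (t + s0 / 2)) * normc (v j 0 l) ^+ 2 = y ^+ 2.
  by rewrite exprMn powR_sqr.
rewrite xy.
have x0 : 0 <= x by exact: powR_ge0.
have y0 : 0 <= y by rewrite mulr_ge0 ?powR_ge0// normc_ge0.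
nra.
Qed.

(** Testing an element [w] of the double dual on the power sequence of
    exponent [s] yields exactly the weighted l^2-condition of index [s]. *)
Lemma rapid_decay_perfect (R : realType) (d : nat -> nat) (lambda : nat -> R)
    (s0 : R) :
  (forall j, 0 < lambda j) ->
  (\sum_(0 <= j <oo) ((d j)%:R * lambda j `^ (- s0))%:E < +oo)%E ->
  perfect (rapid_decay d lambda).
Proof.
move=> lambda_gt0 lambda_sum; apply/seteqP; split; last exact: alpha_dual2_ge.
move=> w wP s.
have /nneseries_sqr_lt_pinfty := wP _ (power_seq_dual s lambda_gt0 lambda_sum).
have nn j l : 0 <= normc (power_seq d lambda s j 0 l) * normc (w j 0 l).
  by rewrite mulr_ge0// normc_ge0.
move=> /(_ (fun j => sumr_ge0 _ (fun l _ => nn j l))).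
apply: nneseries_lt_pinfty => j; rewrite mulr_ge0 ?powR_ge0 ?sqr_ge0//=.
under eq_bigr do rewrite normc_power_seq.
rewrite -mulr_sumr exprMn powR_sqr.
rewrite ler_wpM2l ?powR_ge0// HS_norm_sqr.
rewrite expr2 mulr_suml; apply: ler_sum => l _.
rewrite expr2 ler_wpM2l ?normc_ge0// (bigD1 l)//= lerDl.
by apply: sumr_ge0 => k _; exact: normc_ge0.
Qed.

Theorem theorem4p7 (R : realType) (H : completeNormedModType R[i])
    (ip : {dot H for @Num.conj R[i]}) (d : nat -> nat)
    (e : forall j : nat, 'I_(d j) -> H) (lambda : nat -> R)
    (ip_norm : induces_norm ip)
    (H_separable : separable H)
    (d_gt0 : forall j : nat, (0 < d j)%N)
    (e_basis : orthonormal_basis ip e)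
    (lambda_gt0 : forall j : nat, 0 < lambda j)
    (lambda_nondecr : nondecreasing_seq lambda)
    (lambda_sum : exists2 s0 : R, 0 < s0 &
       (\sum_(0 <= j <oo) ((d j)%:R * lambda j `^ (- s0))%:E < +oo)%E) :
  perfect (Hinfty_seq ip e lambda).
Proof.
have [eO _] := e_basis; have [s0 _ s0_sum] := lambda_sum.
by rewrite (Hinfty_seqE _ ip_norm eO); exact: rapid_decay_perfect s0_sum.
Qed.
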